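(* Let $\mathcal{C}$ be a subcategory of a category $\mathcal{H}$. Then for every ordered $\mathcal{C}$-span $M: U\xleftarrow{\,i\,}W\xrightarrow{\,j\,}V$ the correspondence $$\mathsf{A}=\{(\phi,\phi_\#),(\psi,\psi_\#)\}\longmapsto g_{\mathsf{A}}=\psi_\#\circ\phi_\#^{-1},$$ associating to each $\mathcal{HC}$-atlas $\mathsf{A}$ on $M$ its transition map $g_{\mathsf{A}}$, yields an injective map $\mu'$ - from the isomorphism classes of $\mathcal{HC}$-atlases on $M$ - into the double cosets $\mathcal{E}_{\mathcal{C}}(W,j)\setminus\mathrm{Aut}_{\mathcal{C}}(W)/\mathcal{E}_{\mathcal{C}}(W,i)$. Moreover, $\mu'$ is a bijection if and only if every $g\in\mathrm{Aut}_{\mathcal{C}}(W)$ is the transition map of some $\mathcal{HC}$-atlas on $M$.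
   Context: For a category $\mathcal{K}$, $\mathrm{Aut}_{\mathcal{K}}(X)$ is the group of automorphisms of an object $X$, and $\mathcal{K}^{\mathbf 2}$ is the arrow category: objects are morphisms of $\mathcal{K}$, and a morphism from $i:W\to U$ to $i':W'\to U'$ is a pair $(\alpha,\gamma)$ with $\alpha:U\to U'$, $\gamma:W\to W'$ in $\mathcal{K}$ and $\alpha\circ i=i'\circ\gamma$ (first coordinate: map of targets; second coordinate: map of sources). A $\mathcal{C}$-span is a diagram $M:U\xleftarrow{i}W\xrightarrow{j}V$ in $\mathcal{C}$; it is ordered if $i$ is regarded as the first and $j$ as the second arrow. An $\mathcal{H}$-morphism from $M$ to a $\mathcal{C}$-span $N:\tilde U\xleftarrow{\tilde i}\tilde W\xrightarrow{\tilde j}\tilde V$ is a triple $(\alpha,\gamma,\beta)$ of morphisms $\alpha:U\to\tilde U$, $\gamma:W\to\tilde W$, $\beta:V\to\tilde V$ of $\mathcal{H}$ with $\alpha i=\tilde i\gamma$ and $\beta j=\tilde j\gamma$. An $\mathcal{HC}$-atlas on $M$ is a pair $\mathsf{A}=\{(\phi,\phi_\#)\in\mathrm{Aut}_{\mathcal{H}^{\mathbf 2}}(i),\ (\psi,\psi_\#)\in\mathrm{Aut}_{\mathcal{H}^{\mathbf 2}}(j)\}$ such that the transition map $g_{\mathsf{A}}=\psi_\#\circ\phi_\#^{-1}:W\to W$ belongs to $\mathrm{Aut}_{\mathcal{C}}(W)$. Given $\mathcal{HC}$-atlases $\mathsf{A}=\{(\phi,\phi_\#),(\psi,\psi_\#)\}$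 on $M$ and $\mathsf{B}=\{(\tilde\phi,\tilde\phi_\#),(\tilde\psi,\tilde\psi_\#)\}$ on $N$, an $\mathcal{H}$-morphism $(\alpha,\gamma,\beta):M\to N$ is a morphism of $\mathcal{HC}$-atlases $M^{(\mathsf{A})}\to N^{(\mathsf{B})}$ if its representations $(\tilde\phi\alpha\phi^{-1},\ \tilde\phi_\#\gamma\phi_\#^{-1})$ (from $i$ to $\tilde i$) and $(\tilde\psi\beta\psi^{-1},\ \tilde\psi_\#\gamma\psi_\#^{-1})$ (from $j$ to $\tilde j$) are morphisms of $\mathcal{C}^{\mathbf 2}$. Isomorphisms are the invertible such morphisms, i.e. $\alpha,\gamma,\beta$ are isomorphisms in $\mathcal{H}$ and both representations are isomorphisms in $\mathcal{C}^{\mathbf 2}$. Two atlases $\mathsf{A},\mathsf{B}$ on $M$ are isomorphic if there is an isomorphism $M^{(\mathsf{A})}\to M^{(\mathsf{B})}$. $\mathcal{E}_{\mathcal{C}}(W,i)=\{\hat a\in\mathrm{Aut}_{\mathcal{C}}(W): \exists a\in\mathrm{Aut}_{\mathcal{C}}(U),\ (a,\hat a)\in\mathrm{Aut}_{\mathcal{C}^{\mathbf 2}}(i)\}$ and $\mathcal{E}_{\mathcal{C}}(W,j)=\{\hat b\in\mathrm{Aut}_{\mathcal{C}}(W): \exists b\in\mathrm{Aut}_{\mathcal{C}}(V),\ (b,\hat b)\in\mathrm{Aut}_{\mathcal{C}^{\mathbf 2}}(j)\}$. The set $\mathcal{E}_{\mathcal{C}}(W,j)\setminus\mathrm{Aut}_{\mathcal{C}}(W)/\mathcal{E}_{\mathcal{C}}(W,i)$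 is the orbit set of the action of $\mathcal{E}_{\mathcal{C}}(W,i)\times\mathcal{E}_{\mathcal{C}}(W,j)$ on $\mathrm{Aut}_{\mathcal{C}}(W)$ given by $(\hat a,\hat b)\cdot g=\hat b\circ g\circ\hat a^{-1}$. *)

(* Defs.v *)
From mathcomp Require Import all_boot.
From mathcomp Require Import boolp classical_sets.

Set Implicit Arguments.
Unset Strict Implicit.
Unset Printing Implicit Defensive.

Local Open Scope classical_set_scope.

(* Equality of morphisms is Leibniz equality; [comp f g] is "f after g". *)
Record category := Category {
  ob :> Type;
  hom : ob -> ob -> Type;
  idm : forall X, hom X X;
  comp : forall X Y Z, hom Y Z -> hom X Y -> hom X Z;
  comp_idl : forall X Y (f : hom X Y), comp (idm Y) f = f;
  comp_idr : forall X Y (f : hom X Y), comp f (idm X) = f;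
  comp_assoc : forall X Y Z T (f : hom Z T) (g : hom Y Z) (h : hom X Y),
    comp f (comp g h) = comp (comp f g) h }.

Arguments hom {c} X Y.
Arguments idm {c} X.
Arguments comp {c X Y Z} f g.

Declare Scope category_scope.
Delimit Scope category_scope with cat.
Local Open Scope category_scope.
Notation "f ∘ g" := (comp f g) (at level 40, left associativity) : category_scope.

Record iso (K : category) (X Y : K) := Iso {
  fwd : hom X Y;
  bwd : hom Y X;
  fwdK : bwd ∘ fwd = idm X;
  bwdK : fwd ∘ bwd = idm Y }.

Arguments iso {K} X Y.

Definition is_iso (K : category) (X Y : K) (f : hom X Y) : Prop :=
  exists u : iso X Y, fwd u = f.

Definition aut (K : category) (X : K) := iso X X.

Definition iso_inv (K : category) (X Y : K) (u : iso X Y) : iso Y X :=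
  Iso (bwdK u) (fwdK u).

Lemma iso_comp_subproof (K : category) (X Y Z : K)
    (f : hom Y Z) (f' : hom Z Y) (g : hom X Y) (g' : hom Y X) :
  f' ∘ f = idm Y -> g' ∘ g = idm X -> (g' ∘ f') ∘ (f ∘ g) = idm X.
Proof.
by move=> ff gg; rewrite comp_assoc -(comp_assoc g') ff comp_idr.
Qed.

Definition iso_comp (K : category) (X Y Z : K) (u : iso Y Z) (v : iso X Y) :
    iso X Z :=
  Iso (iso_comp_subproof (fwdK u) (fwdK v)) (iso_comp_subproof (bwdK v) (bwdK u)).

Section ArrowCategory.
Variable K : category.

Record arrow_ob := Arrow { src : K; tgt : K; mor : hom src tgt }.

Record arrow_hom (i i' : arrow_ob) := ArrowHom {
  tgt_map : hom (tgt i) (tgt i');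
  src_map : hom (src i) (src i');
  arrow_square : tgt_map ∘ mor i = mor i' ∘ src_map }.

Lemma arrow_hom_eq (i i' : arrow_ob) (f g : arrow_hom i i') :
  tgt_map f = tgt_map g -> src_map f = src_map g -> f = g.
Proof.
case: f g => [a c s] [a' c' s'] /= eqa eqc; case: _ / eqa s' => s'.
by case: _ / eqc s' => s'; congr ArrowHom; exact: Prop_irrelevance.
Qed.

Lemma arrow_id_square (i : arrow_ob) : idm (tgt i) ∘ mor i = mor i ∘ idm (src i).
Proof. by rewrite comp_idl comp_idr. Qed.

Lemma arrow_comp_square (i j k : arrow_ob) (f : arrow_hom j k) (g : arrow_hom i j) :
  (tgt_map f ∘ tgt_map g) ∘ mor i = mor k ∘ (src_map f ∘ src_map g).
Proof.
by rewrite -comp_assoc arrow_square !comp_assoc arrow_square.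
Qed.

Definition arrow_id (i : arrow_ob) := ArrowHom (arrow_id_square i).
Definition arrow_comp (i j k : arrow_ob) (f : arrow_hom j k) (g : arrow_hom i j) :=
  ArrowHom (arrow_comp_square f g).

Lemma arrow_comp_idl i j (f : arrow_hom i j) : arrow_comp (arrow_id j) f = f.
Proof. by apply: arrow_hom_eq; exact: comp_idl. Qed.

Lemma arrow_comp_idr i j (f : arrow_hom i j) : arrow_comp f (arrow_id i) = f.
Proof. by apply: arrow_hom_eq; exact: comp_idr. Qed.

Lemma arrow_comp_assoc i j k l
    (f : arrow_hom k l) (g : arrow_hom j k) (h : arrow_hom i j) :
  arrow_comp f (arrow_comp g h) = arrow_comp (arrow_comp f g) h.
Proof. by apply: arrow_hom_eq; exact: comp_assoc. Qed.

Definition arrow : category :=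
  Category arrow_comp_idl arrow_comp_idr arrow_comp_assoc.

Definition tgt_iso (i i' : arrow) (u : iso i i') : iso (tgt i) (tgt i') :=
  Iso (f_equal (@tgt_map i i) (fwdK u)) (f_equal (@tgt_map i' i') (bwdK u)).

Definition src_iso (i i' : arrow) (u : iso i i') : iso (src i) (src i') :=
  Iso (f_equal (@src_map i i) (fwdK u)) (f_equal (@src_map i' i') (bwdK u)).

End ArrowCategory.

(* Not assumed full, nor wide, nor replete. *)
Record subcategory (H : category) := Subcategory {
  sub_ob : H -> Prop;
  sub_hom : forall X Y : H, hom X Y -> Prop;
  sub_dom : forall (X Y : H) (f : hom X Y), sub_hom f -> sub_ob X;
  sub_cod : forall (X Y : H) (f : hom X Y), sub_hom f -> sub_ob Y;
  sub_id : forall X : H, sub_ob X -> sub_hom (idm X);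
  sub_comp : forall (X Y Z : H) (f : hom Y Z) (g : hom X Y),
    sub_hom f -> sub_hom g -> sub_hom (f ∘ g) }.

Section SubcategoryAsCategory.
Variables (H : category) (C : subcategory H).

Definition subcat_ob := {X : H | sub_ob C X}.
Definition subcat_hom (X Y : subcat_ob) :=
  {f : hom (proj1_sig X) (proj1_sig Y) | sub_hom C f}.

Definition subcat_id (X : subcat_ob) : subcat_hom X X :=
  exist _ (idm (proj1_sig X)) (sub_id (proj2_sig X)).
Definition subcat_comp (X Y Z : subcat_ob)
    (f : subcat_hom Y Z) (g : subcat_hom X Y) : subcat_hom X Z :=
  exist _ (proj1_sig f ∘ proj1_sig g) (sub_comp (proj2_sig f) (proj2_sig g)).

Lemma subcat_comp_idl X Y (f : subcat_hom X Y) : subcat_comp (subcat_id Y) f = f.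
Proof. by case: f => f Cf; apply: eq_exist; exact: comp_idl. Qed.

Lemma subcat_comp_idr X Y (f : subcat_hom X Y) : subcat_comp f (subcat_id X) = f.
Proof. by case: f => f Cf; apply: eq_exist; exact: comp_idr. Qed.

Lemma subcat_comp_assoc X Y Z T
    (f : subcat_hom Z T) (g : subcat_hom Y Z) (h : subcat_hom X Y) :
  subcat_comp f (subcat_comp g h) = subcat_comp (subcat_comp f g) h.
Proof. by apply: eq_exist; exact: comp_assoc. Qed.

Definition subcat : category :=
  Category subcat_comp_idl subcat_comp_idr subcat_comp_assoc.

Definition incl_ob (X : subcat) : H := proj1_sig X.
Definition incl_hom (X Y : subcat) (f : hom X Y) : hom (incl_ob X) (incl_ob Y) :=
  proj1_sig f.

Definition incl_iso (X Y : subcat) (u : iso X Y) : iso (incl_ob X) (incl_ob Y) :=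
  Iso (f_equal (@incl_hom X X) (fwdK u)) (f_equal (@incl_hom Y Y) (bwdK u)).

Definition incl_arrow (i : arrow subcat) : arrow H := Arrow (incl_hom (mor i)).
Definition incl_arrow_hom (i i' : arrow subcat) (f : hom i i') :
    hom (incl_arrow i) (incl_arrow i') :=
  @ArrowHom H (incl_arrow i) (incl_arrow i')
    (incl_hom (tgt_map f)) (incl_hom (src_map f))
    (f_equal (@incl_hom _ _) (arrow_square f)).

End SubcategoryAsCategory.

Coercion subcat : subcategory >-> category.

(* A span [left_foot <-- apex --> right_foot]. *)
Record span (K : category) := Span {
  left_foot : K;
  apex : K;
  right_foot : K;
  left_leg : hom apex left_foot;
  right_leg : hom apex right_foot }.

Definition left_arrow (K : category) (M : span K) : arrow K := Arrow (left_leg M).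
Definition right_arrow (K : category) (M : span K) : arrow K := Arrow (right_leg M).

Section Atlases.
Variables (H : category) (C : subcategory H).

Record span_hom (M N : span C) := SpanHom {
  left_map : hom (incl_ob (left_foot M)) (incl_ob (left_foot N));
  apex_map : hom (incl_ob (apex M)) (incl_ob (apex N));
  right_map : hom (incl_ob (right_foot M)) (incl_ob (right_foot N));
  left_square :
    left_map ∘ incl_hom (left_leg M) = incl_hom (left_leg N) ∘ apex_map;
  right_square :
    right_map ∘ incl_hom (right_leg M) = incl_hom (right_leg N) ∘ apex_map }.

Definition span_hom_left (M N : span C) (m : span_hom M N) :
    hom (incl_arrow (left_arrow M)) (incl_arrow (left_arrow N)) :=
  @ArrowHom H (incl_arrow (left_arrow M)) (incl_arrow (left_arrow N))
    (left_map m) (apex_map m) (left_square m).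
Definition span_hom_right (M N : span C) (m : span_hom M N) :
    hom (incl_arrow (right_arrow M)) (incl_arrow (right_arrow N)) :=
  @ArrowHom H (incl_arrow (right_arrow M)) (incl_arrow (right_arrow N))
    (right_map m) (apex_map m) (right_square m).

(* [left_chart] is (phi, phi_#) and [right_chart] is (psi, psi_#). *)
Record atlas (M : span C) := Atlas {
  left_chart : aut (incl_arrow (left_arrow M));
  right_chart : aut (incl_arrow (right_arrow M));
  atlas_transition :
    exists g : aut (apex M),
      incl_iso g = iso_comp (src_iso right_chart) (iso_inv (src_iso left_chart)) }.

(* The preimage in Aut_C(W) is unique, since [incl_iso] is injective. *)
Definition transition (M : span C) (A : atlas M) : aut (apex M) :=
  proj1_sig (cid (atlas_transition A)).

Section AtlasMorphisms.
Variables (M N : span C) (A : atlas M) (B : atlas N) (m : span_hom M N).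

Definition left_rep : hom (incl_arrow (left_arrow M)) (incl_arrow (left_arrow N)) :=
  fwd (left_chart B) ∘ span_hom_left m ∘ bwd (left_chart A).
Definition right_rep :
    hom (incl_arrow (right_arrow M)) (incl_arrow (right_arrow N)) :=
  fwd (right_chart B) ∘ span_hom_right m ∘ bwd (right_chart A).

Definition atlas_morphism : Prop :=
  (exists f : hom (left_arrow M) (left_arrow N), incl_arrow_hom f = left_rep) /\
  (exists f : hom (right_arrow M) (right_arrow N), incl_arrow_hom f = right_rep).

Definition atlas_isomorphism : Prop :=
  [/\ atlas_morphism,
      is_iso (left_map m), is_iso (apex_map m) & is_iso (right_map m)] /\
  (exists f : hom (left_arrow M) (left_arrow N),
     is_iso f /\ incl_arrow_hom f = left_rep) /\
  (exists f : hom (right_arrow M) (right_arrow N),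
     is_iso f /\ incl_arrow_hom f = right_rep).

End AtlasMorphisms.

Definition isomorphic_atlases (M : span C) (A B : atlas M) : Prop :=
  exists m : span_hom M M, atlas_isomorphism A B m.

End Atlases.

(* E_K(W, i), where W is the source of the arrow i. *)
Definition extendable (K : category) (i : arrow K) : set (aut (src i)) :=
  [set ah | exists a : aut (tgt i),
     exists u : aut i, tgt_iso u = a /\ src_iso u = ah].
Arguments extendable {K} i.

Definition double_coset_rel (K : category) (M : span K) (g h : aut (apex M)) : Prop :=
  exists ah bh : aut (apex M),
    [/\ extendable (left_arrow M) ah, extendable (right_arrow M) bh
      & h = iso_comp (iso_comp bh g) (iso_inv ah)].

(* The set of classes {y | R x y}, x : T; used only for equivalence relations. *)
Definition quotient (T : Type) (R : T -> T -> Prop) :=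
  {S : set T | exists x, S = [set y | R x y]}.

Definition class (T : Type) (R : T -> T -> Prop) (x : T) : quotient R :=
  exist _ [set y | R x y] (ex_intro _ x erefl).

Definition atlas_classes (H : category) (C : subcategory H) (M : span C) :=
  quotient (@isomorphic_atlases H C M).

Definition atlas_class (H : category) (C : subcategory H) (M : span C) (A : atlas M) :
    atlas_classes M :=
  class (@isomorphic_atlases H C M) A.

Definition double_cosets (K : category) (M : span K) :=
  quotient (@double_coset_rel K M).

Definition double_coset (K : category) (M : span K) (g : aut (apex M)) :
    double_cosets M :=
  class (@double_coset_rel K M) g.

(* Main.v *)
Require Import Defs.
From mathcomp Require Import all_boot.
From mathcomp Require Import boolp classical_sets.

(** An isomorphism [(alpha, gamma, beta)] of atlases [A -> B] is determined by
    its two representations, which are automorphisms of the legs in the arrow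
    category of [C]; conversely, automorphisms [(a, ah)] and [(b, bh)] of the
    legs come from an isomorphism of atlases exactly when the two candidates
    [phi_B#^-1 ah phi_A#] and [psi_B#^-1 bh psi_A#] for [gamma] agree, i.e. when
    [g_B ah = bh g_A].  This is the double coset relation.  Moreover, composing
    the charts of an atlas with automorphisms of the legs in [C] moves its
    transition map through its whole double coset, so the classes hit by [mu']
    consist of transition maps only. *)

Set Implicit Arguments.
Unset Strict Implicit.
Unset Printing Implicit Defensive.

Local Open Scope category_scope.

Lemma class_eqP (T : Type) (R : T -> T -> Prop) (x y : T) :
    (forall x, R x x) -> (forall x y, R x y -> R y x) ->
    (forall y x z, R x y -> R y z -> R x z) ->
  class R x = class R y <-> R x y.
Proof.
move=> Rxx Rsym Rtrans; split=> [Exy | Rxy].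
  have {}Exy : R x = R y := congr1 (@proj1_sig _ _) Exy.
  by rewrite Exy.
apply: eq_exist; apply/seteqP; split=> z /= Rz.
  exact: Rtrans (Rsym _ _ Rxy) Rz.
exact: Rtrans Rxy Rz.
Qed.

(** Preservation of the relations by [F] makes the map well defined on classes, and reflection makes
    it injective. Being the pullback of [R'] along [F], the relation [R] inherits the equivalence
    laws. *)
Lemma quotient_map (T T' : Type) (R : T -> T -> Prop) (R' : T' -> T' -> Prop)
    (F : T -> T') :
    (forall x, R' x x) -> (forall x y, R' x y -> R' y x) ->
    (forall y x z, R' x y -> R' y z -> R' x z) ->
    (forall x y, R x y <-> R' (F x) (F y)) ->
  exists mu : quotient R -> quotient R',
    [/\ forall x, mu (class R x) = class R' (F x),
        injective mu
      & bijective mu <-> (forall y, exists x, R' (F x) y)].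
Proof.
move=> R'xx R'sym R'trans RF.
have classF x y : class R x = class R y <-> class R' (F x) = class R' (F y).
  have R'P := class_eqP (F x) (F y) R'xx R'sym R'trans.
  apply: iff_trans (iff_sym R'P); apply: iff_trans (RF x y).
  apply: class_eqP.
  - by move=> z; apply/RF.
  - by move=> z t /RF/R'sym/RF.
  - by move=> t z w /RF Rzt /RF Rtw; apply/RF; exact: R'trans Rzt Rtw.
have classK U (r : U -> U -> Prop) (S : quotient r) : exists x, S = class r x.
  by case: S => S [x Sx]; exists x; exact: eq_exist.
(* A representative is chosen in each class; [classF] shows that the choice does not matter. *)
pose mu S := class R' (F (proj1_sig (cid (classK _ R S)))).
have muE x : mu (class R x) = class R' (F x).
  by rewrite /mu; case: cid => y /= /classF.
have mu_inj : injective mu.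
  move=> S S'; have [x ->] := classK _ _ S; have [y ->] := classK _ _ S'.
  by rewrite !muE => /classF.
exists mu; split=> //; split=> [[nu nuK muK] y | surjF].
  have [x nux] := classK _ _ (nu (class R' y)).
  by exists x; apply/class_eqP => //; rewrite -muE -nux muK.
have mu_surj S : exists S', mu S' = S.
  have [y ->] := classK _ _ S; have [x Fxy] := surjF y.
  by exists (class R x); rewrite muE; apply/class_eqP.
(* A section of [mu] obtained by choice; injectivity of [mu] makes it a two-sided inverse. *)
pose nu S := proj1_sig (cid (mu_surj S)).
have muK : cancel nu mu by move=> S; rewrite /nu; case: cid.
by exists nu => // S; apply: mu_inj; rewrite muK.
Qed.

Definition iso_id (K : category) (X : K) : aut X :=
  Iso (comp_idl (idm X)) (comp_idl (idm X)).

Section Isomorphisms.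
Variable K : category.

(** Inverses are unique and the proofs of the inverse laws are irrelevant. *)
Lemma iso_eq (X Y : K) (u v : iso X Y) : fwd u = fwd v -> u = v.
Proof.
case: u v => [f g gf fg] [f' g' gf' fg'] /= eqf; case: _ / eqf gf' fg' => gf' fg'.
have eqg : g = g' by rewrite -(comp_idr g) -fg' comp_assoc gf comp_idl.
case: _ / eqg gf' fg' => gf' fg'.
by rewrite (Prop_irrelevance gf gf') (Prop_irrelevance fg fg').
Qed.

Lemma comp_fwdK (X Y Z : K) (u : iso Y Z) (f : hom X Y) :
  bwd u ∘ (fwd u ∘ f) = f.
Proof. by rewrite comp_assoc fwdK comp_idl. Qed.

Lemma comp_bwdK (X Y Z : K) (u : iso Y Z) (f : hom X Z) :
  fwd u ∘ (bwd u ∘ f) = f.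
Proof. by rewrite comp_assoc bwdK comp_idl. Qed.

Lemma comp_conjK (X X' Y Y' : K) (u : iso Y Y') (v : iso X X') (f : hom X' Y') :
  fwd u ∘ (bwd u ∘ f ∘ fwd v) ∘ bwd v = f.
Proof. by rewrite -!comp_assoc bwdK comp_idr comp_bwdK. Qed.

(** An inverse-free form of the relation, with automorphisms of the legs as witnesses instead of
    their restrictions to the apex. *)
Lemma double_coset_relP (M : span K) (g h : aut (apex M)) :
  double_coset_rel g h <->
  exists (u : aut (left_arrow M)) (v : aut (right_arrow M)),
    fwd h ∘ fwd (src_iso u) = fwd (src_iso v) ∘ fwd g.
Proof.
split=> [[_ [_ [[_ [u [_ <-]]] [_ [v [_ <-]]] ->]]] | [u [v E]]].
  exists u, v; rewrite [fwd (iso_comp _ _)]/=.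
  by rewrite -comp_assoc (fwdK (src_iso u)) comp_idr.
exists (src_iso u), (src_iso v); split; [by exists (tgt_iso u), u| |].
  by exists (tgt_iso v), v.
apply: iso_eq; change (fwd h = fwd (src_iso v) ∘ fwd g ∘ bwd (src_iso u)).
by rewrite -E -comp_assoc bwdK comp_idr.
Qed.

Section DoubleCosetEquivalence.
Variable M : span K.

Lemma double_coset_refl (g : aut (apex M)) : double_coset_rel g g.
Proof.
apply/double_coset_relP; exists (iso_id (left_arrow M)), (iso_id (right_arrow M)).
by rewrite /= comp_idl comp_idr.
Qed.

Lemma double_coset_sym (g h : aut (apex M)) :
  double_coset_rel g h -> double_coset_rel h g.
Proof.
move=> /double_coset_relP[u [v E]]; apply/double_coset_relP.
exists (iso_inv u), (iso_inv v).
change (fwd g ∘ bwd (src_iso u) = bwd (src_iso v) ∘ fwd h).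
rewrite -[fwd g](comp_fwdK (src_iso v)) -E -!comp_assoc.
by rewrite (bwdK (src_iso u)) comp_idr.
Qed.

Lemma double_coset_trans (h g k : aut (apex M)) :
  double_coset_rel g h -> double_coset_rel h k -> double_coset_rel g k.
Proof.
move=> /double_coset_relP[u [v E]] /double_coset_relP[u' [v' E']].
apply/double_coset_relP; exists (iso_comp u' u), (iso_comp v' v).
change (fwd k ∘ (fwd (src_iso u') ∘ fwd (src_iso u)) =
  fwd (src_iso v') ∘ fwd (src_iso v) ∘ fwd g).
by rewrite comp_assoc E' -!comp_assoc E.
Qed.

End DoubleCosetEquivalence.
End Isomorphisms.

Section Atlases.
Variables (H : category) (C : subcategory H).

Lemma incl_hom_inj (X Y : C) : injective (@incl_hom H C X Y).
Proof. by move=> [f Cf] [g Cg] /= Efg; exact: eq_exist. Qed.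

Lemma incl_arrow_cancel (i i' : arrow C) (f : hom i' i) (g : hom i i') :
  f ∘ g = idm i -> incl_arrow_hom f ∘ incl_arrow_hom g = idm (incl_arrow i).
Proof.
move=> fg; apply: arrow_hom_eq.
  exact: (congr1 (fun f : arrow_hom i i => incl_hom (tgt_map f)) fg).
exact: (congr1 (fun f : arrow_hom i i => incl_hom (src_map f)) fg).
Qed.

Definition incl_arrow_iso (i i' : arrow C) (u : iso i i') :
    iso (incl_arrow i) (incl_arrow i') :=
  Iso (incl_arrow_cancel (fwdK u)) (incl_arrow_cancel (bwdK u)).

Variable M : span C.

Lemma transitionE (A : atlas M) :
  incl_hom (fwd (transition A)) =
  fwd (src_iso (right_chart A)) ∘ bwd (src_iso (left_chart A)).
Proof. by rewrite /transition; case: cid => g /= /(congr1 (@fwd _ _ _)). Qed.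

(* The sides of the second equation are the two candidates for [gamma]. *)
Lemma transition_intertwine (A B : atlas M)
    (u : aut (left_arrow M)) (v : aut (right_arrow M)) :
  fwd (transition B) ∘ fwd (src_iso u) = fwd (src_iso v) ∘ fwd (transition A) <->
  src_map (bwd (left_chart B) ∘ incl_arrow_hom (fwd u) ∘ fwd (left_chart A)) =
  src_map (bwd (right_chart B) ∘ incl_arrow_hom (fwd v) ∘ fwd (right_chart A)).
Proof.
set a := incl_hom (src_map (fwd u)); set b := incl_hom (src_map (fwd v)).
set pA := src_iso (left_chart A); set pB := src_iso (left_chart B).
set qA := src_iso (right_chart A); set qB := src_iso (right_chart B).
(* The inclusion into [H] is faithful, so the equation may be tested there, where the transition
   maps factor through the charts. *)
transitivity (fwd qB ∘ bwd pB ∘ a = b ∘ (fwd qA ∘ bwd pA)).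
  rewrite -!transitionE; split=> [/(congr1 (@incl_hom _ _ _ _)) // | E].
  exact: incl_hom_inj.
change (fwd qB ∘ bwd pB ∘ a = b ∘ (fwd qA ∘ bwd pA) <->
  bwd pB ∘ a ∘ fwd pA = bwd qB ∘ b ∘ fwd qA).
(* The two equations differ by composition with [bwd qB] on the left and [fwd pA] on the right. *)
split=> E.
  rewrite -[LHS](comp_fwdK qB) !comp_assoc -(comp_assoc (bwd qB)).
  rewrite -(comp_assoc (bwd qB)) E.
  by rewrite -!comp_assoc fwdK comp_idr.
rewrite -[a](comp_idr) -(bwdK pA) -!comp_assoc.
rewrite (comp_assoc a) (comp_assoc (bwd pB)) (comp_assoc (bwd pB)) E.
by rewrite -!comp_assoc comp_bwdK.
Qed.

Lemma isomorphic_atlasesP (A B : atlas M) :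
  isomorphic_atlases A B <-> double_coset_rel (transition A) (transition B).
Proof.
rewrite double_coset_relP; split.
  move=> [m [_ [[_ [[u <-] repL]] [_ [[v <-] repR]]]]]; exists u, v.
  (* Undoing the charts in both representations leaves the two halves of [m], which share the source
     component [apex_map m]. *)
  apply/transition_intertwine; rewrite repL repR /left_rep /right_rep.
  by rewrite -!comp_assoc fwdK fwdK !comp_idr !comp_fwdK.
move=> [u [v /transition_intertwine E]].
(* [wL] and [wR] solve the equations prescribing [u] and [v] as representations; by [E] their source
   components agree, so they glue to a span morphism. *)
pose wL := iso_comp (iso_comp (iso_inv (left_chart B)) (incl_arrow_iso u))
  (left_chart A).
pose wR := iso_comp (iso_comp (iso_inv (right_chart B)) (incl_arrow_iso v))
  (right_chart A).
have sqR : tgt_map (fwd wR) ∘ incl_hom (right_leg M) =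
    incl_hom (right_leg M) ∘ src_map (fwd wL).
  by rewrite [src_map _]E; exact: (arrow_square (fwd wR)).
pose m := @SpanHom H C M M (tgt_map (fwd wL)) (src_map (fwd wL))
  (tgt_map (fwd wR)) (arrow_square (fwd wL)) sqR.
have repL : incl_arrow_hom (fwd u) = left_rep A B m.
  apply: etrans (esym (comp_conjK (left_chart B) (left_chart A) _)) _.
  by congr (_ ∘ _ ∘ _); apply: arrow_hom_eq.
have repR : incl_arrow_hom (fwd v) = right_rep A B m.
  apply: etrans (esym (comp_conjK (right_chart B) (right_chart A) _)) _.
  (* Here [apex_map m] comes from [wL], so the source components match only through [E]. *)
  by congr (_ ∘ _ ∘ _); apply: arrow_hom_eq.
exists m; split; last first.
  by split; [exists (fwd u) | exists (fwd v)]; split=> //; [exists u | exists v].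
split; [by split; [exists (fwd u) | exists (fwd v)] | | |].
- by exists (tgt_iso wL).
- by exists (src_iso wL).
- by exists (tgt_iso wR).
Qed.

(** Composing the charts of [A] with [u] and [v] turns the transition map into [v# g_A u#^-1], which
    is [g]. *)
Lemma transition_saturated (A : atlas M) (g : aut (apex M)) :
  double_coset_rel (transition A) g -> exists B : atlas M, transition B = g.
Proof.
move=> /double_coset_relP[u [v E]].
pose phi := iso_comp (incl_arrow_iso u) (left_chart A).
pose psi := iso_comp (incl_arrow_iso v) (right_chart A).
have gE : incl_hom (fwd g) = fwd (src_iso psi) ∘ bwd (src_iso phi).
  change (incl_hom (fwd g) =
    incl_hom (src_map (fwd v)) ∘ fwd (src_iso (right_chart A)) ∘
    (bwd (src_iso (left_chart A)) ∘ incl_hom (bwd (src_iso u)))).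
  rewrite -comp_assoc (comp_assoc (fwd _)) -transitionE.
  change (incl_hom (fwd g) =
    incl_hom (fwd (src_iso v) ∘ (fwd (transition A) ∘ bwd (src_iso u)))).
  by rewrite comp_assoc -E -comp_assoc bwdK comp_idr.
have trB : exists g : aut (apex M),
    incl_iso g = iso_comp (src_iso psi) (iso_inv (src_iso phi)).
  by exists g; apply: iso_eq; exact: gE.
exists (Atlas trB); apply: iso_eq; apply: incl_hom_inj.
by rewrite transitionE gE.
Qed.

End Atlases.

Theorem theorem5p3p1 (H : category) (C : subcategory H) (M : span C) :
  exists mu : atlas_classes M -> double_cosets M,
    [/\ forall A : atlas M, mu (atlas_class A) = double_coset (transition A),
        injective mu
      & bijective mu <->
        (forall g : aut (apex M), exists A : atlas M, transition A = g)].
Proof.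
have [mu [muE mu_inj mu_bij]] := quotient_map (@double_coset_refl _ M)
  (@double_coset_sym _ M) (@double_coset_trans _ M) (@isomorphic_atlasesP _ _ M).
(* Bijectivity says that every double coset contains a transition map; saturation upgrades this to
   every [g] being one. *)
exists mu; split=> //; rewrite mu_bij; split=> surj g.
  by have [A /transition_saturated] := surj g.
by have [A <-] := surj g; exists A; exact: double_coset_refl.
Qed.
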